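(* Let $f\colon\underline I=I_1\times\cdots\times I_n\to\mathbb R$ be a continuous convex function ($I_i$ intervals), let $H$ be a finite-dimensional Hilbert space, let $T$ be a locally compact Hausdorff space with a Radon measure $\nu$, and let $t\mapsto a_t\in B(H)$ be a unital column field on $T$. Let $t\mapsto\underline x_t=(x_{1t},\dots,x_{nt})$ be a bounded continuous field on $T$ of abelian $n$-tuples of self-adjoint operators on $H$ with $\sigma(x_{it})\subseteq I_i$ for all $i,t$. Put $y_i=\int_T a_t^*x_{it}a_t\,d\nu(t)$, $\underline y=(y_1,\dots,y_n)$, and assume that $\underline y$ is an abelian $n$-tuple. Then $$f(\underline y)\prec_w\int_T a_t^*f(\underline x_t)a_t\,d\nu(t).$$
   Context: A unital column field is a continuous field $t\mapsto a_t$ of operators on $H$ with $\int_T a_t^*a_t\,d\nu(t)=1$. An $n$-tuple is abelian if its entries commute; $f$ of an abelian tuple of self-adjoint operators is defined by joint functional calculus. For a self-adjoint operator $x$ on an $m$-dimensional Hilbert space, $x_{[1]}\ge\cdots\ge x_{[m]}$ denote its eigenvalues counted with multiplicity in decreasing order. For self-adjoint $x,y$ on $H$, $x\prec_w y$ (weak majorization) means $\sum_{i=1}^k x_{[i]}\le\sum_{i=1}^k y_{[i]}$ for $k=1,\dots,m$.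
   Formalization: The integrability of t ↦ a_t^* f(x_t) a_t is assumed; without it the right-hand integral may be undefined, e.g. T=(0,1] with Lebesgue measure, a_t=1, x_t=t, f(s)=1/s on (0,∞). T is also taken to be non-empty. *)

(* Defs.v *)
From HB Require Import structures.
From mathcomp Require Import all_boot all_order all_algebra.
From mathcomp Require Import all_classical all_reals all_analysis.
From mathcomp Require Import complex.

Set Implicit Arguments.
Unset Strict Implicit.
Unset Printing Implicit Defensive.

Import Order.TTheory GRing.Theory Num.Theory.
Import numFieldNormedType.Exports.
Local Open Scope classical_set_scope.
Local Open Scope ring_scope.
Local Open Scope sesquilinear_scope.

Notation borelType T := (g_sigma_algebraType (@open T)).

Section Defs.
Variable R : realType.
Local Notation C := R[i].

Definition radon_measure (T : ptopologicalType)
    (nu : set (borelType T) -> \bar R) : Prop :=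
  (forall K : set T, compact K -> (nu K < +oo)%E) /\
  (forall A : set (borelType T), measurable A ->
     nu A = ereal_inf [set nu U | U in [set U : set T | open U /\ A `<=` U]]) /\
  (forall U : set T, open U ->
     nu U = ereal_sup [set nu K | K in [set K : set T | compact K /\ K `<=` U]]).

Section MxInt.
Variables (T : ptopologicalType) (nu : {measure set (borelType T) -> \bar R}).

Definition mx_integrable m (F : T -> 'M[C]_m) : Prop :=
  forall i j : 'I_m,
    nu.-integrable (setT : set (borelType T)) (fun t => (complex.Re (F t i j))%:E) /\
    nu.-integrable (setT : set (borelType T)) (fun t => (complex.Im (F t i j))%:E).

Definition mx_integral m (F : T -> 'M[C]_m) : 'M[C]_m :=
  \matrix_(i, j) Complex
     (Rintegral nu (setT : set (borelType T)) (fun t => complex.Re (F t i j)))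
     (Rintegral nu (setT : set (borelType T)) (fun t => complex.Im (F t i j))).
End MxInt.

(* continuity of an operator field (norm topology = entrywise, finite dim) *)
Definition mx_continuous (T : ptopologicalType) m (F : T -> 'M[C]_m) : Prop :=
  forall i j : 'I_m, continuous (fun t => complex.Re (F t i j)) /\
                     continuous (fun t => complex.Im (F t i j)).

(* boundedness of an operator field (entrywise, equivalent in finite dim) *)
Definition mx_bounded (T : Type) m (F : T -> 'M[C]_m) : Prop :=
  exists M : R, forall t i j, `|complex.Re (F t i j)| <= M /\ `|complex.Im (F t i j)| <= M.

Definition unital_column_field (T : ptopologicalType)
    (nu : {measure set (borelType T) -> \bar R}) m (a : T -> 'M[C]_m) : Prop :=
  mx_continuous a /\
  mx_integrable nu (fun t => (a t)^t* *m a t) /\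
  mx_integral nu (fun t => (a t)^t* *m a t) = 1%:M.

Definition selfadjoint_tuple m n (x : 'I_n -> 'M[C]_m) : Prop :=
  forall i, x i \is hermsymmx.
Definition abelian_tuple m n (x : 'I_n -> 'M[C]_m) : Prop :=
  forall i j, x i *m x j = x j *m x i.

Definition spectrum_in m (X : 'M[C]_m) (I : interval R) : Prop :=
  forall lam : C, eigenvalue X lam -> exists2 r : R, lam = r%:C%C & r \in I.

Definition joint_diag m n (x : 'I_n -> 'M[C]_m)
    (p : 'M[C]_m * ('I_m -> 'rV[R]_n)) : Prop :=
  p.1 \is unitarymx /\
  forall i, x i = p.1^t* *m diag_mx (\row_k ((p.2 k) 0 i)%:C%C) *m p.1.

(* f(x) = U^* diag(f(d_1), ..., f(d_m)) U  (independent of the choice) *)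
Definition fcalc m n (f : 'rV[R]_n -> R) (x : 'I_n -> 'M[C]_m) : 'M[C]_m :=
  match pselect (exists p, joint_diag x p) with
  | left H => let p := projT1 (cid H) in
              p.1^t* *m diag_mx (\row_k (f (p.2 k))%:C%C) *m p.1
  | right _ => 0
  end.

Definition eigen_decr m (X : 'M[C]_m) : seq R :=
  match pselect (exists s : seq R, sorted (fun a b => b <= a) s /\
                  char_poly X = \prod_(r <- s) ('X - (r%:C%C)%:P)) with
  | left H => projT1 (cid H)
  | right _ => [::]
  end.

Definition weak_majorized m (X Y : 'M[C]_m) : Prop :=
  forall k : nat, (k <= m)%N ->
    \sum_(i < k) nth 0 (eigen_decr X) i <= \sum_(i < k) nth 0 (eigen_decr Y) i.

Definition box n (I : 'I_n -> interval R) : set 'rV[R]_n :=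
  [set v | forall i, v 0 i \in I i].

Definition convex_on n (D : set 'rV[R]_n) (f : 'rV[R]_n -> R) : Prop :=
  forall u v, D u -> D v -> forall l : R, 0 <= l <= 1 ->
    f (l *: u + (1 - l) *: v) <= l * f u + (1 - l) * f v.

End Defs.

(* Main.v *)
Require Import Defs.
From HB Require Import structures.
From mathcomp Require Import all_boot all_order all_algebra.
From mathcomp Require Import all_classical all_reals all_analysis.
From mathcomp Require Import measurable_realfun complex ring lra.

Import Order.TTheory GRing.Theory Num.Theory.
Import numFieldNormedType.Exports.
Local Open Scope classical_set_scope.
Local Open Scope ring_scope.
Local Open Scope sesquilinear_scope.

Set Implicit Arguments.
Unset Strict Implicit.

(* Let [u] be a unit joint eigenvector of [y], with joint eigenvalue [w].
   Diagonalizing each [x t], the vectors [a t u] turn [w] into the barycenter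
   of joint eigenvalues of the [x t] for a probability measure, so Jensen's
   inequality gives [f w <= <u, Y u>] with [Y] the right-hand integral.
   Jensen is obtained by integrating an affine minorant of [f] that is almost
   exact at [w]; no exact one need exist when [w] is on the boundary of the
   box. Summing over the eigenvectors with the [k] largest values [f w], Ky
   Fan's maximum principle for [Y] concludes. *)

(** * Approximate affine minorants of convex functions *)

Section AffineMinorant.
Variables (R : realType) (n : nat).
Implicit Types (u v z w : 'rV[R]_n) (D : set 'rV[R]_n) (f : 'rV[R]_n -> R).

Let dot u v : R := \sum_i u 0 i * v 0 i.

Let dot_ge0 u : 0 <= dot u u.
Proof. by apply: sumr_ge0 => i _; rewrite -expr2 sqr_ge0. Qed.

Let dot_lin (a b : R) u v w :
  dot (a *: u + b *: v) w = a * dot u w + b * dot v w.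
Proof.
rewrite /dot !mulr_sumr -big_split/=; apply: eq_bigr => i _.
by rewrite !mxE; ring.
Qed.

Let dotC u v : dot u v = dot v u.
Proof. by apply: eq_bigr => i _; rewrite mulrC. Qed.

Let dot_sqr_comb (s : R) u v :
  dot (u + s *: v) (u + s *: v) = dot u u + 2 * s * dot u v + s ^+ 2 * dot v v.
Proof.
have -> : u + s *: v = 1 *: u + s *: v by rewrite scale1r.
by rewrite dot_lin ![dot _ (1 *: _ + _)]dotC !dot_lin (dotC v u); ring.
Qed.

Let le_dot (d : R) u i : 0 <= d -> dot u u <= d ^+ 2 -> `|u 0 i| <= d.
Proof.
move=> d0 h; rewrite -(@ler_pXn2r _ 2) ?nnegrE ?normr_ge0// real_normK ?num_real//.
apply: le_trans h; rewrite /dot (bigD1 i)//= -expr2 lerDl.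
by apply: sumr_ge0 => j _; rewrite -expr2 sqr_ge0.
Qed.

(* Convexity propagates the local bound near [w] to a quadratic one on [D]:
   contract [z] towards [w] by the factor [d ^+ 2 / |z - w| ^+ 2]. *)
Lemma convex_quadratic_lower_bound D f w (e d : R) :
  convex_on D f -> (forall u v, D u -> D v -> forall l : R, 0 <= l <= 1 ->
    D (l *: u + (1 - l) *: v)) ->
  D w -> 0 < e -> 0 < d ->
  (forall z, D z -> (forall i, `|z 0 i - w 0 i| <= d) -> f w - e <= f z) ->
  forall z, D z ->
    f w - e <= f z + e / d ^+ 2 * \sum_i (z 0 i - w 0 i) ^+ 2.
Proof.
move=> fcvx Dcvx Dw e0 d0 fnear z Dz.
have -> : \sum_i (z 0 i - w 0 i) ^+ 2 = dot (z - w) (z - w).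
  by apply: eq_bigr => i _; rewrite !mxE expr2.
set N := dot _ _; have N0 : 0 <= N by exact: dot_ge0.
have d20 : 0 < d ^+ 2 by rewrite exprn_gt0.
have [Nd|dN] := leP N (d ^+ 2).
  have : f w - e <= f z.
    apply: fnear => // i; have := le_dot i (ltW d0) Nd; by rewrite !mxE.
  have : 0 <= e / d ^+ 2 * N by rewrite mulr_ge0// divr_ge0// ltW.
  lra.
have Np : 0 < N by exact: lt_trans dN.
set t := d ^+ 2 / N.
have t0 : 0 < t by rewrite divr_gt0.
have t1 : t <= 1 by rewrite ler_pdivrMr// mul1r ltW.
have t01 : 0 <= t <= 1 by rewrite ltW.
have Dt := Dcvx _ _ Dz Dw _ t01.
have ft := fcvx _ _ Dz Dw _ t01.
have : f w - e <= f (t *: z + (1 - t) *: w).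
  apply: fnear => // i.
  have : dot (t *: (z - w)) (t *: (z - w)) <= d ^+ 2.
    have -> : dot (t *: (z - w)) (t *: (z - w)) = d ^+ 2 * t.
      rewrite -[t *: (z - w)]add0r dot_sqr_comb.
      have -> : dot 0 0 = 0 by rewrite /dot big1// => j _; rewrite !mxE mulr0.
      have -> : dot 0 (z - w) = 0 by rewrite /dot big1// => j _; rewrite mxE mul0r.
      rewrite -/N /t; field; exact: lt0r_neq0.
    by rewrite ler_piMr// ltW.
  move=> /(le_dot i (ltW d0)); rewrite !mxE.
  by congr (`| _ | <= _); ring.
(* The contracted point is within [d] of [w], so convexity gives
   [f w - e <= t * f z + (1 - t) * f w]. This is the claim multiplied by [t], up to the nonnegative
   term [t * e]. *)
have -> : e / d ^+ 2 * N = e / t.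
  rewrite /t; field; rewrite !lt0r_neq0//.
have et : e / t * t = e by rewrite divfK// lt0r_neq0.
move=> h; rewrite -(ler_pM2l t0); nra.
Qed.

(* An approximate minimizer [z] of [f + K |. - w| ^+ 2] gives the slope
   [- 2 K (z - w)]; boundedness of [D] controls the second-order error. *)
Lemma convex_affine_minorant D f w (M : R) :
  convex_on D f -> (forall u v, D u -> D v -> forall l : R, 0 <= l <= 1 ->
    D (l *: u + (1 - l) *: v)) ->
  (forall u i, D u -> `|u 0 i| <= M) ->
  D w ->
  (forall e : R, 0 < e -> exists2 d : R, 0 < d &
    forall z, D z -> (forall i, `|z 0 i - w 0 i| <= d) -> f w - e <= f z) ->
  forall e : R, 0 < e -> exists c : 'rV[R]_n, exists b : R,
    (forall u, D u -> \sum_i c 0 i * u 0 i + b <= f u) /\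
    f w - e <= \sum_i c 0 i * w 0 i + b.
Proof.
move=> fcvx Dcvx DM Dw flsc e3 e30.
(* One third is lost in the lower bound [hw]; the other two are the [- 2 * e] in the constant term
   of the minorant. *)
pose e := e3 / 3; have e0 : 0 < e by rewrite /e; lra.
have [d d0 fnear] := flsc e e0.
have fq := convex_quadratic_lower_bound fcvx Dcvx Dw e0 d0 fnear.
set K := e / d ^+ 2 in fq; have K0 : 0 < K by rewrite divr_gt0// exprn_gt0.
pose h z := f z + K * dot (z - w) (z - w).
have hw z : D z -> f w - e <= h z.
  suff -> : h z = f z + K * \sum_i (z 0 i - w 0 i) ^+ 2 by exact: fq.
  by congr (_ + _ * _); apply: eq_bigr => i _; rewrite !mxE expr2.
pose r := \sum_(i < n) (2 * M) ^+ 2.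
have rD u v : D u -> D v -> dot (u - v) (u - v) <= r.
  move=> Du Dv; apply: ler_sum => i _; rewrite !mxE -expr2.
  have := DM _ i Du; have := DM _ i Dv.
  rewrite !ler_norml => /andP[? ?] /andP[? ?]; nra.
have r0 : 0 <= r by apply: sumr_ge0 => i _; rewrite sqr_ge0.
have Kr0 : 0 <= K * r by rewrite mulr_ge0// ltW.
(* A step length at most 1 with [s * (K * r) <= e]. The infimum is approached within [s * e], so
   that after division by [s] the second-order error and the minimization error cost one [e]
   each. *)
pose s := e / (K * r + e).
have s0 : 0 < s by rewrite divr_gt0//; lra.
have s1 : s <= 1 by rewrite ler_pdivrMr; lra.
have sKr : s * (K * r) <= e.
  rewrite /s mulrAC ler_pdivrMr; last lra.
  by rewrite ler_pM2l//; lra.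
have hinf : has_inf (h @` D).
  by split; [exists (h w), w|exists (f w - e) => _ [z Dz <-]; exact: hw].
have [_ [z0 Dz0 <-] hz0] := inf_adherent (mulr_gt0 s0 e0) hinf.
have hmin z : D z -> h z0 <= h z + s * e.
  move=> Dz; apply: ltW; apply: lt_le_trans hz0 _; rewrite lerD2r.
  by apply: ge_inf; [case: hinf|exists z].
pose c : 'rV[R]_n := (- (2 * K)) *: (z0 - w).
have cdot u : \sum_i c 0 i * u 0 i = - (2 * K) * dot (z0 - w) u.
  by rewrite /dot mulr_sumr; apply: eq_bigr => i _; rewrite /c !mxE; ring.
have dotBr x u v : dot x (u - v) = dot x u - dot x v.
  by rewrite /dot -sumrB; apply: eq_bigr => i _; rewrite !mxE; ring.
exists c, (f z0 + 2 * K * dot (z0 - w) z0 - 2 * e); rewrite cdot; split.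
  move=> u Du; rewrite cdot.
  (* Near-minimality of [z0] is tested at the point a fraction [s] of the way from [z0] to [u]: the
     first-order term yields the affine function, and the second-order term is at most [s * e]. *)
  have s01 : 0 <= s <= 1 by rewrite ltW.
  have Ds := Dcvx _ _ Du Dz0 _ s01; have fs := fcvx _ _ Du Dz0 _ s01.
  have := hmin _ Ds; rewrite /h.
  have -> : s *: u + (1 - s) *: z0 - w = (z0 - w) + s *: (u - z0).
    by apply/rowP => i; rewrite !mxE; ring.
  rewrite dot_sqr_comb (dotBr (z0 - w) u z0).
  have := rD _ _ Du Dz0; set X := dot (u - z0) _; set A := dot _ u; set B := dot _ z0.
  set Y := dot (z0 - w) _ => Xr hm.
  have KX : s * (s * (K * X)) <= s * e.
    by rewrite ler_pM2l//; apply: le_trans sKr; rewrite ler_pM2l// ler_pM2l.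
  rewrite -(ler_pM2l s0); lra.
have := hw _ Dz0; have := dot_ge0 (z0 - w).
rewrite /h; have := dotBr (z0 - w) z0 w.
set X := dot _ (z0 - w); set A := dot _ z0; set B := dot _ w => XE X0 hh.
have : 0 <= K * X by rewrite mulr_ge0// ltW.
have e3E : e3 = 3 * e by rewrite /e; field.
rewrite e3E; nra.
Qed.

End AffineMinorant.

(** * Squared moduli and quadratic forms of complex matrices *)

Section QuadraticForm.
Variable R : realType.
Local Notation C := R[i].

(** The squared modulus, valued in [R] so that real order arguments apply directly. *)
Definition csqr (z : C) : R := complex.Re z ^+ 2 + complex.Im z ^+ 2.

Lemma csqr_ge0 z : 0 <= csqr z.
Proof. by rewrite addr_ge0// sqr_ge0. Qed.

Lemma mulc_conjc (z : C) : z * z^* = (csqr z)%:C%C.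
Proof.
case: z => a b; rewrite /csqr; apply/eqP; rewrite eq_complex /=.
by apply/andP; split; apply/eqP; ring.
Qed.

Lemma Re_sumc (I : Type) (s : seq I) (P : pred I) (F : I -> C) :
  complex.Re (\sum_(i <- s | P i) F i) = \sum_(i <- s | P i) complex.Re (F i).
Proof. by elim/big_rec2 : _ => // i y z _ <-; case: z (F i) => ? ? [? ?]. Qed.

Lemma Im_sumc (I : Type) (s : seq I) (P : pred I) (F : I -> C) :
  complex.Im (\sum_(i <- s | P i) F i) = \sum_(i <- s | P i) complex.Im (F i).
Proof. by elim/big_rec2 : _ => // i y z _ <-; case: z (F i) => ? ? [? ?]. Qed.

Lemma Re_mulc (z w : C) : complex.Re (z * w) =
  complex.Re z * complex.Re w - complex.Im z * complex.Im w.
Proof. by case: z w => ? ? [? ?]. Qed.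

Lemma Im_mulc (z w : C) : complex.Im (z * w) =
  complex.Re z * complex.Im w + complex.Im z * complex.Re w.
Proof. by case: z w => ? ? [? ?]. Qed.

(** The quadratic form of [M] at the conjugate transpose of [u]. For hermitian [M] the value is
    already real, and taking the real part only changes its type. *)
Definition qform m (u : 'rV[C]_m) (M : 'M[C]_m) : R :=
  complex.Re ((u *m M *m u^t*) 0 0).

Lemma qform_congr m (u : 'rV[C]_m) (A M : 'M[C]_m) :
  qform u (A^t* *m M *m A) = qform (u *m A^t*) M.
Proof.
by rewrite /qform trmx_mul map_mxM trmxCK !mulmxA.
Qed.

Lemma qform_diag m (u : 'rV[C]_m) (r : 'I_m -> R) :
  qform u (diag_mx (\row_k (r k)%:C%C)) = \sum_k r k * csqr (u 0 k).
Proof.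
rewrite /qform mxE Re_sumc; apply: eq_bigr => k _.
rewrite mul_mx_diag !mxE [_ * (r k)%:C%C]mulrC -mulrA mulc_conjc Re_mulc /=.
by rewrite mul0r subr0.
Qed.

Lemma qform1 m (u : 'rV[C]_m) : qform u 1%:M = \sum_k csqr (u 0 k).
Proof.
rewrite -diag_const_mx (_ : const_mx 1 = \row_k (1 : R)%:C%C).
  by rewrite qform_diag; under eq_bigr do rewrite mul1r.
by apply/rowP => k; rewrite !mxE.
Qed.

Lemma unitary_row_csqr m (U : 'M[C]_m) k : U \is unitarymx ->
  \sum_l csqr (U k l) = 1.
Proof.
move=> /unitarymxP/matrixP/(_ k k); rewrite mxE.
under eq_bigr do rewrite !mxE mulc_conjc.
by rewrite mxE eqxx -rmorph_sum/= => /complexI.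
Qed.

Lemma unitary_col_csqr m (U : 'M[C]_m) l : U \is unitarymx ->
  \sum_k csqr (U k l) = 1.
Proof.
rewrite -trmx_unitary => /(unitary_row_csqr l) <-.
by apply: eq_bigr => k _; rewrite mxE.
Qed.

End QuadraticForm.

(** * Simultaneous diagonalization of commuting hermitian matrices *)

Section JointDiagonalization.
Variable R : realType.
Local Notation C := R[i].

(** Commuting matrices are triangularized by a common unitary. Conjugation by it preserves hermitian
    symmetry, and a hermitian triangular matrix is diagonal with real entries. *)
Lemma joint_diag_exists m n (x : 'I_n -> 'M[C]_m) :
  selfadjoint_tuple x -> abelian_tuple x -> exists p, joint_diag x p.
Proof.
move=> xsa xab.
have [|P Pu /allP Pt] := @cotrigonalization C m [seq x i | i <- enum 'I_n].
  by move=> _ _ /mapP[i _ ->] /mapP[j _ ->]; exact: xab.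
have xP i : P *m x i *m P^t* \is hermsymmx.
  apply/is_hermitianmxP; rewrite expr0 scale1r.
  have /is_hermitianmxP := xsa i; rewrite expr0 scale1r => xiE.
  by rewrite !trmx_mul !map_mxM trmxCK mulmxA -xiE.
pose d k : 'rV[R]_n := \row_i complex.Re ((P *m x i *m P^t*) k k).
exists (P, d); split => //= i.
have dE : P *m x i *m P^t* = diag_mx (\row_k (d k 0 i)%:C%C).
  have /is_hermitianmxP := xP i; rewrite expr0 scale1r => xPiE.
  have /is_trig_mxP tri : is_trig_mx (P *m x i *m P^t*).
    have := Pt (x i) (map_f _ (mem_enum _ i)).
    by rewrite /= /similar_to /= conjymx.
  have hE k l : (P *m x i *m P^t*) k l = ((P *m x i *m P^t*) l k)^*.
    by rewrite {1}xPiE [LHS]mxE [X in X^*]mxE.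
  apply/matrixP => k l; rewrite [RHS]mxE [in RHS]mxE.
  case: (ltngtP k l) => [kl|lk|/val_inj <-].
  - by rewrite tri// -val_eqE (ltn_eqF kl).
  - by rewrite hE tri// conjC0 -val_eqE (gtn_eqF lk).
  - rewrite eqxx mulr1n [d k 0 i]mxE; move: (hE k k).
    case: ((P *m x i *m P^t*) k k) => a b [bN].
    by apply/eqP; rewrite eq_complex /= eqxx; apply/eqP; lra.
by rewrite -dE !mulmxA mulmxKtV// -(invmx_unitary Pu) mulVmx
  ?unitarymx_unit// mul1mx.
Qed.

(** Row [k] of the unitary is a left eigenvector, nonzero since it has norm 1. This carries the
    spectral hypothesis over to the joint eigenvalues. *)
Lemma joint_diag_eigenvalue m n (x : 'I_n -> 'M[C]_m) p i k :
  joint_diag x p -> eigenvalue (x i) ((p.2 k) 0 i)%:C%C.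
Proof.
move=> [Uu xE]; apply/eigenvalueP; exists (row k p.1).
  rewrite (xE i) !mulmxA -row_mul (unitarymxP Uu) -mulmxA -row_mul mul1mx.
  apply/rowP => j; rewrite !mxE (bigD1 k)//= big1 ?addr0.
    by rewrite !mxE eqxx mulr1n.
  by move=> l lk; rewrite !mxE eq_sym (negbTE lk) mulr0n mul0r.
apply: contra_neqN (oner_neq0 C) => /eqP rk0.
have /unitarymxP/matrixP/(_ k k) := Uu; rewrite mxE big1 ?mxE ?eqxx//.
move=> l _; have /rowP/(_ l) := rk0; rewrite !mxE => ->.
by rewrite mul0r.
Qed.

End JointDiagonalization.

(** * Ordered eigenvalues and Ky Fan's maximum principle *)

Section KyFan.
Variable R : realType.
Local Notation C := R[i].

Lemma char_poly_unitary_diag m (U : 'M[C]_m) (r : 'I_m -> R) :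
  U \is unitarymx ->
  char_poly (U^t* *m diag_mx (\row_k (r k)%:C%C) *m U) =
  \prod_k ('X - ((r k)%:C%C)%:P).
Proof.
move=> Uu; set D := diag_mx _.
have UV : U^t* *m U = 1%:M.
  by rewrite -(invmx_unitary Uu) mulVmx// unitarymx_unit.
have -> : char_poly (U^t* *m D *m U) = char_poly D.
  rewrite /char_poly /char_poly_mx !map_mxM /=.
  set A := map_mx polyC (U^t*); set B := map_mx polyC U.
  have AB : A *m B = 1%:M by rewrite -map_mxM UV map_mx1.
  have -> : 'X%:M - A *m map_mx polyC D *m B =
      A *m ('X%:M - map_mx polyC D) *m B.
    by rewrite mulmxBr mulmxBl scalar_mxC -[_%:M *m A *m B]mulmxA AB mulmx1.
  by rewrite !det_mulmx mulrAC -det_mulmx AB det1 mul1r.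
rewrite char_poly_trig; last by rewrite diag_mx_is_trig.
by apply: eq_bigr => k _; rewrite !mxE eqxx mulr1n.
Qed.

(** A decreasing list is determined by the product of its linear factors, so [eigen_decr] returns
    the sorted values of [r]. Keeping the sorted indices [s] lets the top eigenvalues be matched
    with rows of [U]. *)
Lemma eigen_decr_unitary_diag m (U : 'M[C]_m) (r : 'I_m -> R) :
  U \is unitarymx ->
  exists s : seq 'I_m, [/\ perm_eq s (index_enum 'I_m),
    sorted (fun i j => r j <= r i) s &
    eigen_decr (U^t* *m diag_mx (\row_k (r k)%:C%C) *m U) = map r s].
Proof.
move=> Uu; have cE := char_poly_unitary_diag r Uu.
pose s := sort (fun i j => r j <= r i) (index_enum 'I_m).
have rtot : total (fun i j => r j <= r i) by move=> i j; exact: le_total.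
have ps : perm_eq s (index_enum 'I_m) by rewrite perm_sort.
have srt : sorted (fun a b => b <= a) (map r s).
  by rewrite sorted_map; exact: sort_sorted.
exists s; split => //; first exact: sort_sorted.
rewrite /eigen_decr; case: pselect => [H|]; last first.
  case; exists (map r s); split => //.
  by rewrite big_map (perm_big _ ps) cE.
case: (cid H) => t /= [tsrt tE].
apply: (sorted_eq _ _ tsrt srt).
- by move=> a b c ba ac; exact: le_trans ac ba.
- by move=> a b /andP[ba ab]; apply/le_anti; rewrite ab ba.
apply: (perm_map_inj (@complexI R)).
apply: prod_XsubC_eq; rewrite !big_map -tE cE.
by rewrite (perm_big _ ps).
Qed.

(** The linear programming core of Ky Fan's principle: weights in [[0, 1]] of total mass [k] do best
    when placed fully on the [k] largest values. *)
Lemma weighted_sum_le_top (m k : nat) (mu w : 'I_m -> R) (s : seq 'I_m) :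
  perm_eq s (index_enum 'I_m) -> sorted (fun i j => mu j <= mu i) s ->
  (k <= m)%N -> (forall l, 0 <= w l <= 1) -> \sum_l w l = k%:R ->
  \sum_l mu l * w l <= \sum_(l <- take k s) mu l.
Proof.
move=> ps ss km w01 wk.
have sm : size s = m.
  by rewrite (perm_size ps) [index_enum _]unlock -enumT size_enum_ord.
case: k km wk => [_ w0|k km wk].
  rewrite take0 big_nil big1// => l _.
  have /eqP := w0; rewrite psumr_eq0; last by move=> i _; case/andP: (w01 i).
  by move=> /allP/(_ l (mem_index_enum _))/= /eqP ->; rewrite mulr0.
(* Now [k.+1] values are retained, so index [k] holds the smallest of them, the threshold [c];
   [Ordinal km] only serves as the default of [nth]. *)
pose l0 := nth (Ordinal km) s k; pose c := mu l0.
have sp i j : (i <= j < m)%N -> mu (nth l0 s j) <= mu (nth l0 s i).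
  case/andP=> ij jm; have [->//|nij] := eqVneq i j.
  have tr : transitive (fun i j => mu j <= mu i).
    by move=> a b d ab bd; exact: le_trans bd ab.
  have ltij : (i < j)%N by rewrite ltn_neqAle nij.
  by apply: (sorted_ltn_nth tr l0 ss) => //; rewrite inE sm// (ltn_trans ltij).
have l0E : l0 = nth l0 s k by apply: set_nth_default; rewrite sm.
have hi (l : 'I_m) : l \in take k.+1 s -> c <= mu l.
  case/(nthP l0) => i; rewrite size_takel ?sm// => ik.
  rewrite nth_take// => <-; rewrite /c {1}l0E.
  by apply: sp; rewrite -ltnS ik.
have lo (l : 'I_m) : l \in drop k.+1 s -> mu l <= c.
  case/(nthP l0) => i; rewrite size_drop sm => ik.
  rewrite nth_drop => <-; rewrite /c {2}l0E.
  apply: sp; rewrite -ltn_subRL ik andbT.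
  by rewrite (leq_trans (leqnSn k))// leq_addr.
(* Both sides drop by [c] times [k.+1]. After the shift, retained terms are nonnegative with weight
   at most 1, and the others are nonpositive. *)
suff : \sum_l (mu l - c) * w l <= \sum_(l <- take k.+1 s) (mu l - c).
  under eq_bigr do rewrite mulrBl.
  rewrite !sumrB -mulr_sumr wk big_const_seq count_predT size_takel ?sm//.
  by rewrite iter_addr_0 mulr_natr lerD2r.
rewrite -(perm_big _ ps)/= -{1}[s](cat_take_drop k.+1) big_cat/=.
rewrite -[leRHS]addr0; apply: lerD.
  rewrite !big_seq; apply: ler_sum => l /hi cl.
  by rewrite ler_piMr ?subr_ge0//; case/andP: (w01 l).
rewrite big_seq; apply: sumr_le0 => l /lo cl.
by rewrite mulr_le0_ge0 ?subr_le0//; case/andP: (w01 l).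
Qed.

(** The rows of [U] with the [k] largest [r] are orthonormal, and over [k] orthonormal vectors the
    quadratic form sums to at most the [k] largest [mu]. *)
Lemma weak_majorized_qform m (U V : 'M[C]_m) (r mu : 'I_m -> R) :
  U \is unitarymx -> V \is unitarymx ->
  (forall k, r k <= qform (row k U) (V^t* *m diag_mx (\row_k (mu k)%:C%C) *m V)) ->
  weak_majorized (U^t* *m diag_mx (\row_k (r k)%:C%C) *m U)
                 (V^t* *m diag_mx (\row_k (mu k)%:C%C) *m V).
Proof.
move=> Uu Vu rle k km.
have [s [ps ss ->]] := eigen_decr_unitary_diag r Uu.
have [t [pt st ->]] := eigen_decr_unitary_diag mu Vu.
have sumE (g : 'I_m -> R) (q : seq 'I_m) : perm_eq q (index_enum 'I_m) ->
    \sum_(i < k) nth 0 (map g q) i = \sum_(l <- take k q) g l.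
  move=> pq; have sq : size q = m.
    by rewrite (perm_size pq) [index_enum _]unlock -enumT size_enum_ord.
  rewrite -(big_map g xpredT id) map_take (big_nth 0) big_mkord.
  rewrite size_takel ?size_map ?sq//.
  by apply: eq_bigr => i _; rewrite nth_take.
rewrite !sumE//.
have Wu : U *m V^t* \is unitarymx by rewrite mul_unitarymx// trmxC_unitary.
set W := U *m V^t* in Wu.
(* The squared length of the projection of row [l] of [V] on the span of the selected rows of [U].
   Unit columns of [W] give [w l <= 1]; unit rows give total mass [k]. *)
pose w l := \sum_(j <- take k s) csqr (W j l).
apply: (@le_trans _ _ (\sum_l mu l * w l)).
  have -> : \sum_l mu l * w l = \sum_l \sum_(j <- take k s) mu l * csqr (W j l).
    by apply: eq_bigr => l _; rewrite mulr_sumr.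
  rewrite exchange_big/=; apply: ler_sum => j _.
  apply: le_trans (rle j) _; rewrite qform_congr qform_diag.
  by apply: ler_sum => l _; rewrite -row_mul mxE.
apply: weighted_sum_le_top => // [l|].
  apply/andP; split; first by apply: sumr_ge0 => j _; exact: csqr_ge0.
  rewrite -(unitary_col_csqr l Wu) -(perm_big _ ps)/=.
  rewrite -[X in _ <= \sum_(_ <- X) _](cat_take_drop k) big_cat/= lerDl.
  by apply: sumr_ge0 => j _; exact: csqr_ge0.
rewrite exchange_big/= (eq_bigr (fun=> 1)); last by move=> j _; exact: unitary_row_csqr.
rewrite big_const_seq count_predT size_takel ?iter_addr_0//.
by rewrite (perm_size ps) [index_enum _]unlock -enumT size_enum_ord.
Qed.

Lemma joint_diag_qform m n (x : 'I_n -> 'M[C]_m) p i k :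
  joint_diag x p -> (p.2 k) 0 i = qform (row k p.1) (x i).
Proof.
move=> [Uu xE].
rewrite xE qform_congr -row_mul (unitarymxP Uu) qform_diag (bigD1 k)//= big1.
  by rewrite !mxE eqxx /csqr /= expr1n expr0n /= addr0 addr0 mulr1.
by move=> l lk; rewrite !mxE eq_sym (negbTE lk) /csqr /= expr0n /= addr0 mulr0.
Qed.

(** The eigenvalue is the quadratic form at a unit row, whose entries have real and imaginary parts
    at most 1 in absolute value. Each of the [m * m] terms expands into four real products bounded
    by [M]. *)
Lemma joint_diag_bounded m n (x : 'I_n -> 'M[C]_m) p i k (M : R) :
  joint_diag x p ->
  (forall a b, `|complex.Re (x i a b)| <= M /\ `|complex.Im (x i a b)| <= M) ->
  `|(p.2 k) 0 i| <= \sum_(a < m) \sum_(b < m) 4 * M.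
Proof.
move=> [Uu xE] xM.
rewrite (joint_diag_qform i k (conj Uu xE)).
have U1 l : `|complex.Re (p.1 k l)| <= 1 /\ `|complex.Im (p.1 k l)| <= 1.
  have h : csqr (p.1 k l) <= 1.
    rewrite -(unitary_row_csqr k Uu) (bigD1 l)//= lerDl.
    by apply: sumr_ge0 => j _; exact: csqr_ge0.
  have := sqr_ge0 (complex.Re (p.1 k l)); have := sqr_ge0 (complex.Im (p.1 k l)).
  by move: h; rewrite /csqr !ler_norml; split; apply/andP; split; nra.
rewrite /qform mxE Re_sumc; under eq_bigr do rewrite mxE mulr_suml Re_sumc.
rewrite exchange_big/=; apply: le_trans (ler_norm_sum _ _ _) _.
apply: ler_sum => a _; apply: le_trans (ler_norm_sum _ _ _) _.
apply: ler_sum => b _; rewrite !mxE.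
have [ra ia] := U1 a; have [rb ib] := U1 b; have [rx ix] := xM a b.
have n3 (z1 z2 z3 : R) : `|z1| <= 1 -> `|z2| <= M -> `|z3| <= 1 -> `|z1 * z2 * z3| <= M.
  move=> h1 h2 h3; rewrite !normrM -[M]mulr1 ler_pM// ?mulr_ge0//.
  by rewrite -[M]mul1r ler_pM.
case: (p.1 k a) ra ia => a1 a2 /= ra ia; case: (p.1 k b) rb ib => b1 b2 /= rb ib.
case: (x i a b) rx ix => c1 c2 /= rx ix.
have := n3 _ _ _ ra rx rb; have := n3 _ _ _ ia ix rb.
have := n3 _ _ _ ra ix ib; have := n3 _ _ _ ia rx ib.
rewrite !ler_norml => /andP[? ?] /andP[? ?] /andP[? ?] /andP[? ?].
by apply/andP; split => /=; lra.
Qed.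

End KyFan.

(** * Real integrals and barycenters in intervals *)

Section RealIntegral.
Context d (T : measurableType d) (R : realType).
Variable mu : {measure set T -> \bar R}.
Implicit Types f g : T -> R.
Local Notation intg f := (mu.-integrable setT (EFin \o f)).

Lemma integrableR_sum (I : Type) (s : seq I) (h : I -> T -> R) :
  (forall i, intg (h i)) -> intg (fun t => \sum_(i <- s) h i t).
Proof.
move=> hi; rewrite (_ : EFin \o _ = fun t => (\sum_(i <- s) (h i t)%:E)%E).
  by apply: (integrable_sum measurableT) => i _; exact: hi.
by apply/funext => t /=; rewrite sumEFin.
Qed.

Lemma integrableRZ (k : R) f : intg f -> intg (fun t => k * f t).
Proof.
move=> fi; rewrite (_ : EFin \o _ = fun t => (k%:E * (f t)%:E)%E).
  exact: integrableZl.
by apply/funext => t /=; rewrite EFinM.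
Qed.

Lemma integrableRD f g : intg f -> intg g -> intg (fun t => f t + g t).
Proof. by move=> fi gi; exact: (integrableD measurableT fi gi). Qed.

Lemma Rintegral_sum (I : Type) (s : seq I) (h : I -> T -> R) :
  (forall i, intg (h i)) ->
  Rintegral mu setT (fun t => \sum_(i <- s) h i t) =
  \sum_(i <- s) Rintegral mu setT (h i).
Proof.
move=> hi; elim: s => [|i s ih].
  rewrite big_nil -[RHS](mul0r (fine (mu setT))) -Rintegral_cst//.
  by apply: eq_Rintegral => t _; rewrite big_nil.
rewrite big_cons -ih -RintegralD//; last exact: integrableR_sum.
by apply: eq_Rintegral => t _; rewrite big_cons.
Qed.

(** A nonnegative function with zero integral vanishes almost everywhere, and [g] vanishes wherever
    [f] does. *)
Lemma Rintegral_eq0_dominated f g :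
  intg f -> intg g -> (forall t, 0 <= f t) ->
  (forall t, f t = 0 -> g t = 0) ->
  Rintegral mu setT f = 0 -> Rintegral mu setT g = 0.
Proof.
move=> fi gi f0 fg If0.
have mf := measurable_int _ fi; have mg := measurable_int _ gi.
have If : (\int[mu]_t `|(EFin \o f) t| = 0)%E.
  rewrite (_ : (\int[mu]_t _ = \int[mu]_t (f t)%:E)%E).
    by rewrite -(fineK (integrable_fin_num measurableT fi)) -/(Rintegral _ _ _) If0.
  by apply: eq_integral => t _ /=; rewrite ger0_norm.
have /ae_eq_integral_abs f_ae := If.
have {}f_ae := f_ae measurableT mf.
have : ae_eq mu setT (EFin \o g) (cst 0%E).
  apply: filterS f_ae => t ft _ /=.
  by have /(_ I) [] := ft => /fg ->.
move/(ae_eq_integral_abs mu measurableT mg) => Ig.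
apply/eqP; rewrite -normr_le0.
apply: le_trans (le_normr_Rintegral measurableT gi) _.
by rewrite /Rintegral (_ : (\int[mu]_t _ = \int[mu]_t `|(EFin \o g) t|)%E) ?Ig.
Qed.

(** Equality of the integrals would make [c * w - f] vanish almost everywhere, hence also [w], whose
    integral is 1. *)
Lemma Rintegral_lt_mean f w (c : R) : intg f -> intg w ->
  Rintegral mu setT w = 1 ->
  (forall t, f t <= c * w t) -> (forall t, f t = c * w t -> w t = 0) ->
  Rintegral mu setT f < c.
Proof.
move=> fi wi w1 fle feq.
have cwi := integrableRZ c wi.
have Icw : Rintegral mu setT (fun t => c * w t) = c by rewrite RintegralZl// w1 mulr1.
have nfi : intg (fun t => c * w t - f t) by exact: (integrableB measurableT cwi fi).
rewrite lt_neqAle -{2}Icw le_Rintegral// andbT; apply/eqP => fc.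
suff : Rintegral mu setT w = 0 by rewrite w1 => /eqP; rewrite oner_eq0.
apply: (Rintegral_eq0_dominated nfi) => // [t|t /eqP|].
- by rewrite subr_ge0.
- by rewrite subr_eq0 eq_sym => /eqP/feq.
- by rewrite RintegralB// Icw fc subrr.
Qed.

(** The weights [om] have total mass 1, so the integral of [f] is a barycenter of points of [J].
    Open endpoints require the strict comparison of means. *)
Lemma Rintegral_mean_in_itv (I : finType) (J : interval R) f w
    (p om : T -> I -> R) :
  intg f -> intg w -> Rintegral mu setT w = 1 ->
  (forall t l, p t l \in J) -> (forall t l, 0 <= om t l) ->
  (forall t, f t = \sum_l p t l * om t l) ->
  (forall t, w t = \sum_l om t l) ->
  Rintegral mu setT f \in J.
Proof.
move=> fi wi w1 pJ om0 fE wE.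
have nfi : intg (fun t => - f t).
  have := integrableRZ (-1) fi; congr (mu.-integrable _ _).
  by apply/funext => t /=; rewrite mulN1r.
have INf : Rintegral mu setT (fun t => - f t) = - Rintegral mu setT f.
  rewrite -mulN1r -RintegralZl//.
  by apply: eq_Rintegral => t _; rewrite mulN1r.
have upper_le c q : (forall t l, q t l <= c) ->
    forall t, \sum_l q t l * om t l <= c * w t.
  move=> qc t; rewrite wE mulr_sumr; apply: ler_sum => l _.
  by rewrite ler_wpM2r.
have upper_eq c q : (forall t l, q t l < c) ->
    forall t, \sum_l q t l * om t l = c * w t -> w t = 0.
  move=> qc t /eqP; rewrite eq_sym -subr_eq0 wE mulr_sumr -sumrB.
  rewrite psumr_eq0; last first.
    by move=> l _; rewrite -mulrBl mulr_ge0// subr_ge0 ltW.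
  move=> /allP h; apply: big1 => l _.
  have := h l (mem_index_enum _); rewrite /= -mulrBl mulf_eq0 subr_eq0.
  by rewrite gt_eqF//= => /eqP.
have Ifc c : Rintegral mu setT (fun t => c * w t) = c.
  by rewrite RintegralZl// w1 mulr1.
have fNE t : - f t = \sum_l - p t l * om t l.
  by rewrite fE -sumrN; apply: eq_bigr => l _; rewrite mulNr.
(* Without any pair [(t, l)] the integral of [w] would be 0. The point [p t0 l0] of [J] excludes a
   lower bound [+oo] and an upper bound [-oo]. *)
have [t0 [l0 _]] : exists (t : T) (l : I), True.
  apply: contrapT => h; have := w1; rewrite (_ : Rintegral _ _ _ = 0).
    by move/eqP; rewrite eq_sym oner_eq0.
  rewrite -[RHS](mul0r (fine (mu setT))) -Rintegral_cst//.
  apply: eq_Rintegral => t _; rewrite wE big1// => l.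
  by case: h; exists t, l.
have := pJ t0 l0; case: J pJ => lo hi pJ; rewrite !itv_boundlr => /andP[plo phi].
apply/andP; split.
(* The lower endpoint is handled as an upper endpoint for [- f]. The flag [b] being true means
   closed for a lower endpoint and open for an upper one. *)
- case: lo pJ plo => [b c|b] pJ plo; last first.
    by case: b {pJ} plo.
  case: b pJ {plo} => pJ.
  + rewrite bnd_simp -lerN2 -INf -(Ifc (- c)); apply: le_Rintegral => //.
      exact: integrableRZ.
    move=> t _; rewrite fNE; apply: (upper_le (- c) (fun t l => - p t l)) => {}t l.
    by have := pJ t l; rewrite itv_boundlr !bnd_simp lerN2 => /andP[].
  + rewrite bnd_simp -ltrN2 -INf.
    have h t l : - p t l < - c.
      by have := pJ t l; rewrite itv_boundlr !bnd_simp ltrN2 => /andP[].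
    apply: (Rintegral_lt_mean nfi wi) => // t; rewrite fNE.
      by apply: (upper_le (- c) (fun t l => - p t l)) => s l; exact: ltW.
    exact: (upper_eq (- c) (fun t l => - p t l)).
- case: hi pJ phi => [b c|b] pJ phi; last first.
    by case: b {pJ} phi.
  case: b pJ {phi} => pJ.
  + rewrite bnd_simp.
    have h t l : p t l < c.
      by have := pJ t l; rewrite itv_boundlr !bnd_simp => /andP[].
    apply: (Rintegral_lt_mean fi wi) => // t; rewrite fE.
      by apply: (upper_le c p) => s l; exact: ltW.
    exact: (upper_eq c p).
  + rewrite bnd_simp -(Ifc c); apply: le_Rintegral => //.
      exact: integrableRZ.
    move=> t _; rewrite fE; apply: (upper_le c p) => {}t l.
    by have := pJ t l; rewrite itv_boundlr !bnd_simp => /andP[].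
Qed.

End RealIntegral.

(** * Measurability and integration of matrix fields *)

Section MatrixIntegral.
Variables (R : realType) (T : ptopologicalType).
Variable nu : {measure set (borelType T) -> \bar R}.
Local Notation C := R[i].
Local Notation mfun f := (measurable_fun (setT : set (borelType T)) f).

Lemma borel_continuous_measurable (f : T -> R) : continuous f ->
  mfun (f : borelType T -> R).
Proof.
move=> /continuousP cf; apply: (measurability _ (RGenOpens.measurableE R)).
move=> _ [_ [a [b ->] <-]]; rewrite setTI; apply: sub_sigma_algebra.
by apply: cf; exact: interval_open.
Qed.

Definition mx_measurable m n (F : T -> 'M[C]_(m, n)) :=
  forall i j, mfun (fun t : borelType T => complex.Re (F t i j)) /\
              mfun (fun t : borelType T => complex.Im (F t i j)).

Lemma mx_continuous_measurable m (F : T -> 'M[C]_m) :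
  mx_continuous F -> mx_measurable F.
Proof.
by move=> cF i j; have [? ?] := cF i j; split; exact: borel_continuous_measurable.
Qed.

Lemma mx_measurable_adj m n (F : T -> 'M[C]_(m, n)) :
  mx_measurable F -> mx_measurable (fun t => (F t)^t*).
Proof.
move=> mF i j; have [mr mi] := mF j i; split.
  by apply: eq_measurable_fun mr => t _ /=; rewrite !mxE; case: (F t j i).
apply: eq_measurable_fun (measurable_funN mi) => t _ /=; rewrite !mxE.
by case: (F t j i).
Qed.

Lemma mx_measurableM m n p (F : T -> 'M[C]_(m, n)) (G : T -> 'M[C]_(n, p)) :
  mx_measurable F -> mx_measurable G -> mx_measurable (fun t => F t *m G t).
Proof.
move=> mF mG i j; split.
  rewrite (_ : (fun t => _) = fun t => \sum_k
    (complex.Re (F t i k) * complex.Re (G t k j) -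
     complex.Im (F t i k) * complex.Im (G t k j))); last first.
    apply/funext => t; rewrite mxE Re_sumc.
    by apply: eq_bigr => k _; rewrite Re_mulc.
  apply: measurable_sum => k; have [? ?] := mF i k; have [? ?] := mG k j.
  by apply: measurable_funB; exact: measurable_funM.
rewrite (_ : (fun t => _) = fun t => \sum_k
  (complex.Re (F t i k) * complex.Im (G t k j) +
   complex.Im (F t i k) * complex.Re (G t k j))); last first.
  apply/funext => t; rewrite mxE Im_sumc.
  by apply: eq_bigr => k _; rewrite Im_mulc.
apply: measurable_sum => k; have [? ?] := mF i k; have [? ?] := mG k j.
by apply: measurable_funD; exact: measurable_funM.
Qed.

Local Notation intg f := (nu.-integrable (setT : set (borelType T)) (EFin \o f)).

Let dominated_integrable (f g : T -> R) :
  mfun (f : borelType T -> R) -> (forall t, `|f t| <= g t) -> intg g -> intg f.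
Proof.
move=> mf fg; apply: le_integrable => //; first exact: measurableT_comp.
by move=> t _ /=; rewrite lee_fin (le_trans (fg t))// ler_norm.
Qed.

(** Every entry is dominated by a constant times the trace of [(a t)^t* *m a t], which is integrable
    for a column field. *)
Lemma mx_integrable_congr m (a x : T -> 'M[C]_m) :
  mx_continuous a -> mx_continuous x -> mx_bounded x ->
  mx_integrable nu (fun t => (a t)^t* *m a t) ->
  mx_integrable nu (fun t => (a t)^t* *m x t *m a t).
Proof.
move=> /mx_continuous_measurable ma /mx_continuous_measurable mx [M xM] ai.
have mF : mx_measurable (fun t => (a t)^t* *m x t *m a t).
  by apply: mx_measurableM => //; apply: mx_measurableM => //; exact: mx_measurable_adj.
pose tr t := \sum_i complex.Re (((a t)^t* *m a t) i i).
have tri : intg tr by apply: integrableR_sum => i; exact: (ai i i).1.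
have le_tr t p i : csqr (a t p i) <= tr t.
  have trE : tr t = \sum_i \sum_p csqr (a t p i).
    apply: eq_bigr => j _; rewrite mxE Re_sumc; apply: eq_bigr => q _.
    by rewrite !mxE mulrC mulc_conjc.
  rewrite trE (bigD1 i)//= (bigD1 p)//= -addrA lerDl addr_ge0//.
    by apply: sumr_ge0 => q _; exact: csqr_ge0.
  by apply: sumr_ge0 => j _; apply: sumr_ge0 => q _; exact: csqr_ge0.
pose K : R := \sum_(q < m) \sum_(p < m) 4 * M.
have Ktri : intg (fun t => K * tr t) by exact: integrableRZ.
have bnd t i j : `|complex.Re (((a t)^t* *m x t *m a t) i j)| <= K * tr t /\
                 `|complex.Im (((a t)^t* *m x t *m a t) i j)| <= K * tr t.
  (* The outer factors satisfy [2 * |z1 * z3| <= z1 ^+ 2 + z3 ^+ 2], so their product is at most the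
     trace. *)
  have n3 (z1 z2 z3 : R) : z1 ^+ 2 <= tr t -> `|z2| <= M -> z3 ^+ 2 <= tr t ->
      `|z1 * z2 * z3| <= M * tr t.
    move=> h1 h2 h3; rewrite !normrM mulrAC mulrC ler_pM// ?mulr_ge0//.
    by rewrite -normrM ler_norml; apply/andP; split; nra.
  have b3 p q : `|complex.Re ((a t p i)^* * x t p q * a t q j)| <= 4 * M * tr t /\
      `|complex.Im ((a t p i)^* * x t p q * a t q j)| <= 4 * M * tr t.
    have := le_tr t p i; have := le_tr t q j; have := xM t p q.
    case: (a t p i) => a1 a2; case: (a t q j) => b1 b2; case: (x t p q) => c1 c2.
    rewrite /csqr /= => -[hc1 hc2] hb ha.
    have a1t : a1 ^+ 2 <= tr t by have := sqr_ge0 a2; lra.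
    have a2t : a2 ^+ 2 <= tr t by have := sqr_ge0 a1; lra.
    have b1t : b1 ^+ 2 <= tr t by have := sqr_ge0 b2; lra.
    have b2t : b2 ^+ 2 <= tr t by have := sqr_ge0 b1; lra.
    have := n3 _ _ _ a1t hc1 b1t; have := n3 _ _ _ a1t hc1 b2t.
    have := n3 _ _ _ a1t hc2 b1t; have := n3 _ _ _ a1t hc2 b2t.
    have := n3 _ _ _ a2t hc1 b1t; have := n3 _ _ _ a2t hc1 b2t.
    have := n3 _ _ _ a2t hc2 b1t; have := n3 _ _ _ a2t hc2 b2t.
    rewrite !ler_norml.
    do 8 move=> /andP[? ?].
    by split; apply/andP; split; lra.
  have KE : K * tr t = \sum_(q < m) \sum_(p < m) 4 * M * tr t.
    by rewrite mulr_suml; apply: eq_bigr => q _; rewrite mulr_suml.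
  have E : ((a t)^t* *m x t *m a t) i j =
      \sum_q \sum_p (a t p i)^* * x t p q * a t q j.
    rewrite mxE; apply: eq_bigr => q _; rewrite mxE mulr_suml.
    by apply: eq_bigr => p _; rewrite !mxE.
  rewrite E KE Re_sumc Im_sumc; split; apply: le_trans (ler_norm_sum _ _ _) _;
    apply: ler_sum => q _; rewrite ?Re_sumc ?Im_sumc;
    apply: le_trans (ler_norm_sum _ _ _) _; apply: ler_sum => p _;
    by case: (b3 p q).
move=> i j; have [mr mi] := mF i j.
by split; [apply: dominated_integrable mr _ Ktri => t; case: (bnd t i j)
          |apply: dominated_integrable mi _ Ktri => t; case: (bnd t i j)].
Qed.

(** Displays the form as a real linear combination of real and imaginary parts of entries, so that
    it commutes with entrywise integration. *)
Let qform_entries m (u : 'rV[C]_m) (M : 'M[C]_m) :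
  qform u M = \sum_b \sum_a
    (complex.Re (u 0 a * (u 0 b)^*) * complex.Re (M a b) +
     - complex.Im (u 0 a * (u 0 b)^*) * complex.Im (M a b)).
Proof.
rewrite /qform mxE Re_sumc; apply: eq_bigr => b _.
rewrite mxE mulr_suml Re_sumc; apply: eq_bigr => a _; rewrite !mxE.
by case: (u 0 a) (M a b) (u 0 b) => ? ? [? ?] [? ?] /=; ring.
Qed.

Lemma integrable_qform m (u : 'rV[C]_m) (F : T -> 'M[C]_m) :
  mx_integrable nu F -> intg (fun t => qform u (F t)).
Proof.
move=> Fi; rewrite (_ : (fun t => _) = fun t => \sum_b \sum_a
    (complex.Re (u 0 a * (u 0 b)^*) * complex.Re (F t a b) +
     - complex.Im (u 0 a * (u 0 b)^*) * complex.Im (F t a b))); last first.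
  by apply/funext => t; exact: qform_entries.
apply: integrableR_sum => b; apply: integrableR_sum => a.
by apply: integrableRD; apply: integrableRZ; case: (Fi a b).
Qed.

Lemma Rintegral_qform m (u : 'rV[C]_m) (F : T -> 'M[C]_m) :
  mx_integrable nu F ->
  Rintegral nu (setT : set (borelType T)) (fun t => qform u (F t)) =
  qform u (mx_integral nu F).
Proof.
move=> Fi; rewrite (_ : (fun t => _) = fun t => \sum_b \sum_a
    (complex.Re (u 0 a * (u 0 b)^*) * complex.Re (F t a b) +
     - complex.Im (u 0 a * (u 0 b)^*) * complex.Im (F t a b))); last first.
  by apply/funext => t; exact: qform_entries.
have ti a b : intg (fun t =>
    (complex.Re (u 0 a * (u 0 b)^*) * complex.Re (F t a b) +
     - complex.Im (u 0 a * (u 0 b)^*) * complex.Im (F t a b))).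
  by apply: integrableRD; apply: integrableRZ; case: (Fi a b).
rewrite Rintegral_sum; last by move=> b; exact: integrableR_sum.
rewrite qform_entries; apply: eq_bigr => b _.
rewrite Rintegral_sum//; apply: eq_bigr => a _; have [Fr Fm] := Fi a b.
rewrite RintegralD//; [|exact: integrableRZ|exact: integrableRZ].
by rewrite !RintegralZl// mxE.
Qed.

Lemma mx_integral_hermitian m (F : T -> 'M[C]_m) :
  (forall t, F t \is hermsymmx) -> mx_integrable nu F ->
  mx_integral nu F \is hermsymmx.
Proof.
move=> Fh Fi; apply/is_hermitianmxP; rewrite expr0 scale1r.
have FE t i j : F t i j = (F t j i)^*.
  have /is_hermitianmxP := Fh t; rewrite expr0 scale1r => FE.
  by rewrite {1}FE !mxE.
apply/matrixP => i j; rewrite !mxE; apply/eqP; rewrite eq_complex /=.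
apply/andP; split; apply/eqP.
  by apply: eq_Rintegral => t _; rewrite FE; case: (F t j i).
rewrite -mulN1r -RintegralZl//; last exact: (Fi j i).2.
by apply: eq_Rintegral => t _; rewrite FE mulN1r; case: (F t j i).
Qed.

End MatrixIntegral.

(** * Jensen's inequality for the quadratic form at a unit vector *)

Section Jensen.
Variable R : realType.
Local Notation C := R[i].

Lemma hermsymmx_congr m (A M : 'M[C]_m) :
  M \is hermsymmx -> A^t* *m M *m A \is hermsymmx.
Proof.
move=> /is_hermitianmxP; rewrite expr0 scale1r => ME.
apply/is_hermitianmxP; rewrite expr0 scale1r.
by rewrite !trmx_mul !map_mxM trmxCK mulmxA -ME.
Qed.

Lemma hermsymmx_real_diag m (r : 'I_m -> R) :
  diag_mx (\row_k (r k)%:C%C) \is hermsymmx.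
Proof.
apply/is_hermitianmxP; rewrite expr0 scale1r tr_diag_mx map_diag_mx.
congr diag_mx; apply/rowP => k; rewrite !mxE.
by apply/eqP; rewrite eq_complex /= oppr0 !eqxx.
Qed.

(** Exposes the diagonalization selected by [fcalc], so that the tuple and its image under [f] are
    read in the same basis. *)
Lemma fcalc_joint_diag m n (f : 'rV[R]_n -> R) (x : 'I_n -> 'M[C]_m) :
  selfadjoint_tuple x -> abelian_tuple x ->
  exists p, joint_diag x p /\
    fcalc f x = p.1^t* *m diag_mx (\row_k (f (p.2 k))%:C%C) *m p.1.
Proof.
move=> xsa xab; rewrite /fcalc; case: pselect => [H|]; last first.
  by case; exact: joint_diag_exists.
by exists (projT1 (cid H)); split => //; exact: (projT2 (cid H)).
Qed.

Lemma box_convex n (I : 'I_n -> interval R) (u v : 'rV[R]_n) (l : R) :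
  box I u -> box I v -> 0 <= l <= 1 -> box I (l *: u + (1 - l) *: v).
Proof.
move=> Iu Iv /andP[l0 l1] i; rewrite !mxE.
have [uv|/ltW vu] := leP (u 0 i) (v 0 i).
- apply: (@interval_is_interval _ (I i) _ _ (Iu i) (Iv i)).
  by apply/andP; split; nra.
- apply: (@interval_is_interval _ (I i) _ _ (Iv i) (Iu i)).
  by apply/andP; split; nra.
Qed.

Lemma within_continuous_lower n (D : set 'rV[R]_n) (f : 'rV[R]_n -> R) w :
  {within D, continuous f} -> D w ->
  forall e : R, 0 < e -> exists2 d : R, 0 < d &
    forall z, D z -> (forall i, `|z 0 i - w 0 i| <= d) -> f w - e <= f z.
Proof.
move=> /subspace_continuousP cf Dw e e0.
have /cvgrPdist_le/(_ e e0) := cf w Dw.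
rewrite /prop_near1 /within /= => /nbhs_ballP[d d0 wd].
(* Halving turns the closed bound on coordinates into membership in the open ball. *)
exists (d / 2); first by rewrite divr_gt0.
move=> z Dz zd; have : `|f w - f z| <= e.
  apply: wd => //; split => // i j; rewrite ord1.
  rewrite /ball /= distrC; apply: le_lt_trans (zd j) _.
  by rewrite ltr_pdivrMr// ltr_pMr// ltr1n.
by rewrite ler_norml => /andP[_]; lra.
Qed.

(** The weights [om t l] and [nu] form a probability measure on pairs [(t, l)] under which the joint
    eigenvalues have mean [w] and their images under [f] have the right-hand side as mean. *)
Lemma jensen_qform (n m : nat) (I : 'I_n -> interval R) (f : 'rV[R]_n -> R)
  (T : ptopologicalType) (nu : {measure set (borelType T) -> \bar R})
  (a : T -> 'M[C]_m) (x : T -> 'I_n -> 'M[C]_m) (u : 'rV[C]_m) (w : 'rV[R]_n) :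
  {within box I, continuous f} ->
  convex_on (box I) f ->
  unital_column_field nu a ->
  (forall i, mx_continuous (fun t => x t i)) ->
  (forall i, mx_bounded (fun t => x t i)) ->
  (forall t, selfadjoint_tuple (x t) /\ abelian_tuple (x t)) ->
  (forall t i, spectrum_in (x t i) (I i)) ->
  mx_integrable nu (fun t => (a t)^t* *m fcalc f (x t) *m a t) ->
  qform u 1%:M = 1 ->
  (forall i, w 0 i =
     qform u (mx_integral nu (fun t => (a t)^t* *m x t i *m a t))) ->
  f w <= qform u (mx_integral nu (fun t => (a t)^t* *m fcalc f (x t) *m a t)).
Proof.
move=> cf fcvx [ac [ai a1]] xc xb xsa xI fxi u1 wE.
have xi i := mx_integrable_congr ac (xc i) (xb i) ai.
pose p t := projT1 (cid (fcalc_joint_diag f (xsa t).1 (xsa t).2)).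
have [px pf] : (forall t, joint_diag (x t) (p t)) /\ (forall t, fcalc f (x t) =
    (p t).1^t* *m diag_mx (\row_k (f ((p t).2 k))%:C%C) *m (p t).1).
  by split => t; have [] := projT2 (cid (fcalc_joint_diag f (xsa t).1 (xsa t).2)).
(* Squared coordinates of the image of [u] under [a t] in the joint eigenbasis of [x t]. *)
pose om t l := csqr ((u *m (a t)^t* *m (p t).1^t*) 0 l).
have om0 t l : 0 <= om t l by exact: csqr_ge0.
have qE t (r : 'I_m -> R) : qform u ((a t)^t* *m
    ((p t).1^t* *m diag_mx (\row_k (r k)%:C%C) *m (p t).1) *m a t) =
    \sum_l r l * om t l.
  by rewrite !qform_congr qform_diag.
pose W t := qform u ((a t)^t* *m a t); pose X i t := qform u ((a t)^t* *m x t i *m a t).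
have WE t : W t = \sum_l om t l.
  have [pu _] := px t.
  under eq_bigr do rewrite -[om _ _]mul1r.
  rewrite -qE (_ : \row_k _ = const_mx 1); last by apply/rowP => k; rewrite !mxE.
  rewrite diag_const_mx mulmx1 -(invmx_unitary pu) mulVmx ?unitarymx_unit//.
  by rewrite mulmx1.
have XE i t : X i t = \sum_l (p t).2 l 0 i * om t l.
  by have [_ xE] := px t; rewrite /X xE qE.
have Wi := integrable_qform u ai; have Xi i := integrable_qform u (xi i).
have W1 : Rintegral nu (setT : set (borelType T)) W = 1.
  by rewrite Rintegral_qform// a1 u1.
have IX i : Rintegral nu (setT : set (borelType T)) (X i) = w 0 i.
  by rewrite Rintegral_qform// wE.
have pI t l : box I ((p t).2 l).
  move=> i; have [r] := xI t i _ (joint_diag_eigenvalue i l (px t)).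
  by move=> /complexI ->.
have [B pB] : exists B : R, forall t l i, `|(p t).2 l 0 i| <= B.
  have [M xM] := choice xb.
  exists (\sum_i `|\sum_(a < m) \sum_(b < m) 4 * M i|) => t l i.
  rewrite (bigD1 i)//=; apply: ler_wpDr; first by rewrite sumr_ge0.
  apply: le_trans (ler_norm _).
  by apply: (joint_diag_bounded _ (px t)) => b c; exact: xM.
have wI : box I w.
  move=> i; rewrite -IX.
  by apply: (Rintegral_mean_in_itv (Xi i) Wi W1 _ om0 (XE i) WE) => t l; exact: pI.
have wB i : `|w 0 i| <= B.
  suff : w 0 i \in `[- B, B] by rewrite in_itv /= ler_norml.
  rewrite -IX.
  apply: (Rintegral_mean_in_itv (Xi i) Wi W1 _ om0 (XE i) WE) => t l.
  by rewrite in_itv /= -ler_norml.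
(* The box may be unbounded, while the affine minorant is built on a bounded set; cutting at [B]
   keeps all joint eigenvalues and [w]. *)
pose D := [set v : 'rV[R]_n | box I v /\ forall i, `|v 0 i| <= B].
have Dcvx v z : D v -> D z -> forall l : R, 0 <= l <= 1 -> D (l *: v + (1 - l) *: z).
  move=> [vI vB] [zI zB] l l01; split; first exact: box_convex.
  move=> i; rewrite !mxE; have := vB i; have := zB i; case/andP: l01 => l0 l1.
  rewrite !ler_norml => /andP[? ?] /andP[? ?].
  by apply/andP; split; nra.
have fD : convex_on D f by move=> v z [vI _] [zI _]; exact: fcvx.
have flow (e : R) : 0 < e -> exists2 d : R, 0 < d &
    forall z, D z -> (forall i, `|z 0 i - w 0 i| <= d) -> f w - e <= f z.
  move=> e0; have [d d0 h] := within_continuous_lower cf wI e0.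
  by exists d => // z [zI _]; exact: h.
apply/ler_addgt0Pr => e e0.
have [c [b [cf_le cw]]] := convex_affine_minorant fD Dcvx
  (fun v i (Dv : D v) => Dv.2 i) (conj wI wB) flow e0.
rewrite -lerBlDr; apply: le_trans cw _.
have cXi : nu.-integrable (setT : set (borelType T))
    (EFin \o (fun t => \sum_i c 0 i * X i t)).
  by apply: integrableR_sum => i; exact: (integrableRZ (c 0 i) (Xi i)).
have bWi : nu.-integrable (setT : set (borelType T)) (EFin \o (fun t => b * W t)).
  exact: (integrableRZ b Wi).
(* Since [W] has integral 1, the constant [b] can be integrated as [b * W t], even when [nu] has
   infinite mass. *)
have -> : \sum_i c 0 i * w 0 i + b =
    Rintegral nu (setT : set (borelType T)) (fun t => \sum_i c 0 i * X i t + b * W t).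
  rewrite RintegralD// RintegralZl// W1 mulr1 Rintegral_sum; last first.
    by move=> i; exact: (integrableRZ (c 0 i) (Xi i)).
  by congr (_ + _); apply: eq_bigr => i _; rewrite -IX;
    rewrite (RintegralZl (c 0 i) measurableT (Xi i)).
rewrite -Rintegral_qform//; apply: le_Rintegral => //.
- exact: (integrableRD cXi bWi).
- exact: integrable_qform.
move=> t _; rewrite pf qE WE mulr_sumr.
under eq_bigr do rewrite XE mulr_sumr.
rewrite exchange_big/= -big_split/=; apply: ler_sum => l _.
(* The minorant inequality at each joint eigenvalue, multiplied by its weight. *)
have := cf_le _ (conj (pI t l) (pB t l)) => /(ler_wpM2r (om0 t l)).
apply: le_trans; rewrite mulrDl mulr_suml lerD2r.
by apply: ler_sum => i _; rewrite mulrA.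
Qed.

End Jensen.

Unset Implicit Arguments.
Set Strict Implicit.

Theorem mainTheorem6 (R : realType) (n m : nat) (I : 'I_n -> interval R)
  (f : 'rV[R]_n -> R)
  (T : ptopologicalType) (nu : {measure set (borelType T) -> \bar R})
  (a : T -> 'M[R[i]]_m) (x : T -> 'I_n -> 'M[R[i]]_m) :
  {within box I, continuous f} ->
  convex_on (box I) f ->
  hausdorff_space T ->
  locally_compact [set: T] ->
  radon_measure nu ->
  unital_column_field nu a ->
  (forall i, mx_continuous (fun t => x t i)) ->
  (forall i, mx_bounded (fun t => x t i)) ->
  (forall t, selfadjoint_tuple (x t) /\ abelian_tuple (x t)) ->
  (forall t i, spectrum_in (x t i) (I i)) ->
  let y := fun i => mx_integral nu (fun t => (a t)^t* *m x t i *m a t) in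
  abelian_tuple y ->
  mx_integrable nu (fun t => (a t)^t* *m fcalc f (x t) *m a t) ->
  weak_majorized (fcalc f y)
                 (mx_integral nu (fun t => (a t)^t* *m fcalc f (x t) *m a t)).
Proof.
move=> cf fcvx _ _ _ aU xc xb xsa xI y yab fxi.
have ysa : selfadjoint_tuple y.
  move=> i; apply: mx_integral_hermitian.
    by move=> t; apply: hermsymmx_congr; exact: (xsa t).1.
  by have [ac [ai _]] := aU; exact: mx_integrable_congr.
have [p [py ->]] := fcalc_joint_diag f ysa yab.
set Y := mx_integral _ _.
have Yh : Y \is hermsymmx.
  apply: mx_integral_hermitian => // t; apply: hermsymmx_congr.
  have [q [_ ->]] := fcalc_joint_diag f (xsa t).1 (xsa t).2.
  by apply: hermsymmx_congr; exact: hermsymmx_real_diag.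
(* The single matrix [Y] is diagonalized as a tuple of length 1. *)
have [q [qu /(_ ord0) YE]] :=
  @joint_diag_exists R m 1 (fun=> Y) (fun=> Yh) (fun _ _ => erefl).
have [pu _] := py.
rewrite YE; apply: weak_majorized_qform => // k; rewrite -YE.
(* Jensen is applied at row [k] of [p.1], a unit vector at which the forms of the [y i] are the
   coordinates of the joint eigenvalue [p.2 k]. *)
apply: (jensen_qform cf fcvx aU xc xb xsa xI fxi).
  rewrite qform1 -[RHS](unitary_row_csqr k pu).
  by apply: eq_bigr => l _; rewrite mxE.
by move=> i; rewrite (joint_diag_qform i k py).
Qed.
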